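(* Let $D$ be a finite simply-laced tree that contains the Dynkin diagram $\mathbf{E}_6$ as a subgraph; that is, $D$ has a vertex $v$ of degree at least $3$ such that at least two of the connected components of $D\setminus\{v\}$ (the arms at $v$) contain at least two vertices each. Then, apart from the fixed labelings (each of which forms a class by itself), the labelings of $D$ form exactly two equivalence classes: the class of all non-fixed labelings with an odd number of components, and the class of all non-fixed labelings with an even number of components.
   Context: Reeder's puzzle on a finite connected simple graph $D$: a labeling is a vector $a=(a_i)$ with $a_i\in\mathbb{Z}/2\mathbb{Z}$ for each vertex $i$. For a vertex $i$, the move $T_i$ sends $a$ to $a'$ with $a'_j=a_j$ for $j\neq i$ and $a'_i=a_i+\sum_k a_k \pmod 2$, the sum over all neighbors $k$ of $i$. Two labelings are equivalent if one can be obtained from the other by a finite sequence of moves. A labeling is fixed if $T_i(a)=a$ for every vertex $i$. The components of a labeling are the connected components of the subgraph induced on the set of vertices labeled $1$. *)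

(* Defs.v *)
From HB Require Import structures.
From mathcomp Require Import all_boot all_order all_algebra.

Set Implicit Arguments.
Unset Strict Implicit.
Unset Printing Implicit Defensive.

Import GRing.Theory.
Local Open Scope ring_scope.

Section Graph.

Variables (V : finType) (e : rel V).

Definition simple_graph : Prop := symmetric e /\ irreflexive e.

Definition connected_graph : Prop :=
  (0 < #|V|)%N /\ forall x y : V, connect e x y.

(* The bound 2 is because [ucycle] also accepts the empty sequence and, for an
   edge xy, the closed walk [:: x; y], neither of which is a graph cycle. *)
Definition acyclic_graph : Prop :=
  forall c : seq V, ucycle e c -> (size c <= 2)%N.

Definition tree : Prop :=
  [/\ simple_graph, connected_graph & acyclic_graph].

Definition induced (S : {set V}) : rel V :=
  [rel x y | [&& x \in S, y \in S & e x y]].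

(* Vertex sets of the connected components of the subgraph induced on S. *)
Definition components (S : {set V}) : {set {set V}} :=
  equivalence_partition (connect (induced S)) S.

Definition degree (v : V) : nat := #|[set w | e v w]|.

Definition arms (v : V) : {set {set V}} := components [set~ v].

(* In a tree this says that E6, a trivalent vertex with arms of lengths 1, 2, 2,
   occurs as a subgraph. *)
Definition contains_E6 : Prop :=
  exists v : V, (3 <= degree v)%N /\
    (2 <= #|[set A in arms v | (2 <= #|A|)%N]|)%N.

End Graph.

Definition labeling (V : finType) := {ffun V -> 'Z_2}.

Section Puzzle.

Variables (V : finType) (e : rel V).

Definition move (i : V) (a : labeling V) : labeling V :=
  [ffun j => if j == i then a i + \sum_(k | e i k) a k else a j].

Definition one_move : rel (labeling V) :=
  [rel a b | [exists i, b == move i a]].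

(* Each [move i] is an involution ([e] being irreflexive), so the reflexive
   transitive closure is symmetric. *)
Definition equiv : rel (labeling V) := connect one_move.

Definition equiv_classes : {set {set labeling V}} :=
  equivalence_partition equiv [set: labeling V].

Definition fixed (a : labeling V) : bool := [forall i, move i a == a].

Definition num_components (a : labeling V) : nat :=
  #|components e [set i | a i == 1]|.

Definition nonfixed_odd : {set labeling V} :=
  [set a | ~~ fixed a & odd (num_components a)].

Definition nonfixed_even : {set labeling V} :=
  [set a | ~~ fixed a & ~~ odd (num_components a)].

End Puzzle.

(* Main.v *)
Require Import Defs.
From HB Require Import structures.
From mathcomp Require Import all_boot all_order all_algebra.

(** Let [B] be the alternating form on labelings given by adjacency. The move at
    [i] is the transvection of the basis vector at [i], so the fixed labelings
    form the radical of [B]. In a forest, adding a vertex with [k] neighbours in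
    [S] changes the number of components by [1 - k], and a move acts only
    when [k] is odd; hence the parity of the number of components is invariant.

    Conversely, every non-fixed labeling can be brought to a fixed
    representative of its parity supported on E6. Build the tree from E6 by
    successively adding leaves [x] with neighbour [y]. A labeling of [S + x] can
    be moved to a labeling [c] with [c x = 0] and [c y = 1]. If [c] is in the
    radical of [S], two transvections along labelings [b + wa], [b + wb], which
    are branches from [y] ending at two neighbours of the trivalent vertex [v],
    turn [c + x] into [c + x + wa + wb]; after removing [x], this is no longer
    in the radical of [S]. On E6 itself the claim is a finite computation. *)

Set Implicit Arguments.
Unset Strict Implicit.
Unset Printing Implicit Defensive.

Import GRing.Theory.
Local Open Scope ring_scope.

(* MathComp's [generic_quotient] also has an [equiv]. *)
Local Notation equiv := Defs.equiv.

(** * Arithmetic in ['Z_2] *)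

Lemma Z2_cases (x : 'Z_2) : x = 0 \/ x = 1.
Proof. by case: x => [[|[|m]] lt_m] //; [left | right]; apply: val_inj. Qed.

Lemma Z2_neq1 (x : 'Z_2) : (x != 1) = (x == 0).
Proof. by case: (Z2_cases x) => ->. Qed.

Lemma Z2_addxx (x : 'Z_2) : x + x = 0.
Proof. by case: (Z2_cases x) => ->; apply: val_inj. Qed.

Lemma Z2_natr (n : nat) : n%:R = (odd n)%:R :> 'Z_2.
Proof.
elim: n => [|n IHn] //=; rewrite -natr1 IHn.
by case: (odd n) => /=; apply: val_inj.
Qed.

Lemma labeling_addxx (V : finType) (a : labeling V) : a + a = 0.
Proof. by apply/ffunP => j; rewrite !ffunE Z2_addxx. Qed.

(** * Connected vertex sets and uniqueness of neighbours in forests *)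

Section ConnectedSets.

Variables (V : finType) (e : rel V).
Hypothesis e_sym : symmetric e.

Definition connected_set (S : {set V}) : Prop :=
  {in S &, forall y z, connect (induced e S) y z}.

Lemma connect_ind (T : finType) (r : rel T) (P : T -> Prop) (x y : T) :
  connect r x y -> P x -> (forall z t, P z -> r z t -> P t) -> P y.
Proof.
move=> /connectP[p rp ->] Px Pr; elim: p x Px rp => [|z p IHp] x Px //=.
by case/andP=> rxz; apply: IHp; apply: Pr rxz.
Qed.

Lemma induced_sym S : symmetric (induced e S).
Proof. by move=> x y; rewrite /induced /= e_sym andbCA. Qed.

Lemma connect_induced_sym S : connect_sym (induced e S).
Proof. exact/sym_connect_sym/induced_sym. Qed.

Lemma connect_induced_sub (S U : {set V}) y z :
  S \subset U -> connect (induced e S) y z -> connect (induced e U) y z.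
Proof.
move=> sSU; apply: connect_sub => s t /and3P[sS tS est].
by apply: connect1; rewrite /induced /= !(subsetP sSU) ?est.
Qed.

Lemma connected_set1 v : connected_set [set v].
Proof. by move=> y z /set1P-> /set1P->. Qed.

Lemma connected_setU1 S x y :
  connected_set S -> y \in S -> e x y -> connected_set (x |: S).
Proof.
move=> Sc yS exy.
have xy: connect (induced e (x |: S)) x y.
  by apply: connect1; rewrite /induced /= setU11 setU1r ?exy.
have y_to z : z \in x |: S -> connect (induced e (x |: S)) y z.
  case/setU1P=> [->|zS]; first by rewrite connect_induced_sym.
  by apply: connect_induced_sub (Sc y z yS zS); apply: subsetUr.
move=> s t sS tS; apply: connect_trans (y_to t tS).
by rewrite connect_induced_sym y_to.
Qed.

(** Growth induction: in a connected graph an edge leaves every nonempty proper vertex set, so a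
    property can be carried from [S] to the whole graph one adjacent vertex at a time. *)
Lemma connected_setT_ind (P : {set V} -> Prop) (S : {set V}) v :
    (forall x y : V, connect e x y) -> v \in S ->
    P S ->
    (forall (T : {set V}) x y, P T -> x \notin T -> y \in T -> e x y ->
       P (x |: T)) ->
  P [set: V].
Proof.
move=> econ vS PS PU.
have [n] := ubnP #|~: S|; elim: n => // n IHn in S vS PS *; rewrite ltnS => Sn.
have [SE|] := eqVneq S [set: V]; first by rewrite -SE.
rewrite -subTset => /subsetPn[z _ zS].
have [[x y] /and3P[/= xS yS xy]] :
    exists p : V * V, [&& p.1 \notin S, p.2 \in S & e p.1 p.2].
  apply/existsP; apply: contraNT zS; rewrite negb_exists => /forallP nex.
  apply: (connect_ind (P := fun t => t \in S) (econ v z) vS) => s' t s'S st.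
  by apply: contraT => tS; have := nex (t, s'); rewrite /= tS s'S e_sym st.
apply: (IHn (x |: S)); [by rewrite setU1r|exact: PU PS xS yS xy|].
apply: leq_trans Sn; apply: proper_card; rewrite setCU setIC.
apply/properP; split; first exact: subsetIl.
by exists x; rewrite !inE ?eqxx ?xS.
Qed.

Hypothesis e_acyclic : acyclic_graph e.

(** Otherwise a duplicate-free path from [y] to [z] inside [S], closed up through [x] outside [S],
    would be a cycle with at least three vertices. *)
Lemma acyclic_uniq S x y z :
    connect (induced e S) y z -> y \in S -> x \notin S -> e x y -> e x z ->
  y = z.
Proof.
move=> /connectP[p0 + z_def] yS xS exy; rewrite {}z_def.
case/shortenP=> p ip up _ exz.
have [-> //|p_n0] := eqVneq p [::].
have pS : {subset y :: p <= S}.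
  move: ip yS {up exz exy p_n0}; elim: p y => [|t p IHp] y /=.
    by move=> _ yS s; rewrite inE => /eqP->.
  case/andP=> /and3P[_ tS _] pp yS s; rewrite inE => /predU1P[->//|].
  exact: IHp pp tS s.
have ep : path e y p by apply: sub_path ip => s t /and3P[].
have := @e_acyclic [:: x, y & p].
rewrite /ucycle /= rcons_path exy ep e_sym exz /=.
rewrite -[_ && uniq p]/(uniq (y :: p)) up.
rewrite (contra (pS x) xS) => /(_ isT).
by case: (p) p_n0.
Qed.

Lemma acyclic_nbr S x y : connected_set S -> x \notin S -> y \in S -> e x y ->
  {in S, forall z, e x z = (z == y)}.
Proof.
move=> Sc xS yS exy z zS; apply/idP/eqP => [exz|->//].
by apply/esym/(acyclic_uniq (Sc y z yS zS) yS xS).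
Qed.

End ConnectedSets.

(** * Counting components when a vertex is added *)

Section Components.

Variables (V : finType) (e : rel V).
Hypothesis e_sym : symmetric e.
Hypothesis e_acyclic : acyclic_graph e.

Definition block (S : {set V}) (z : V) : {set V} :=
  [set t in S | connect (induced e S) z t].

Lemma componentsE S : components e S = block S @: S.
Proof. by []. Qed.

Lemma block_eq S z t : connect (induced e S) z t -> block S z = block S t.
Proof.
move=> zt; apply/setP=> s; rewrite !inE.
by rewrite (same_connect (connect_induced_sym e_sym S) zt).
Qed.

Lemma mem_block (S : {set V}) z : z \in S -> z \in block S z.
Proof. by move=> zS; rewrite inE zS connect0. Qed.

(* Adding [x] merges the components of [S] adjacent to [x], each of which holds
   exactly one neighbour of [x]. *)
Lemma odd_components_setU1 (S : {set V}) x : x \notin S ->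
  odd #|components e (x |: S)| =
    odd #|components e S| (+) ~~ odd #|[set k in S | e x k]|.
Proof.
move=> xS; set A := [set k in S | e x k].
pose D := [set z in S | [disjoint block S z & A]].
have sAS : A \subset S by apply/subsetP=> z; rewrite inE => /andP[].
have sSx : S \subset x |: S by apply: subsetUr.
have cS : components e S = block S @: A :|: block S @: D.
  rewrite componentsE -imsetU; apply/setP=> K; apply/imsetP/imsetP; last first.
    case=> z zAD ->; exists z => //.
    by case/setUP: zAD => [/(subsetP sAS)//|]; rewrite inE => /andP[].
  case=> z zS ->; case: (boolP [disjoint block S z & A]) => [dz|].
    by exists z => //; rewrite !inE zS dz orbT.
  case/pred0Pn=> t /andP[/= tz tA]; exists t; first by rewrite inE tA.
  by apply: block_eq; move: tz; rewrite inE => /andP[].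
have dS : [disjoint block S @: A & block S @: D].
  apply/pred0P=> K; apply/negbTE/negP=> /andP[/= /imsetP[t tA ->] /imsetP[z zD]].
  move: zD; rewrite inE => /andP[_ dz] tz; move/pred0P: dz => /(_ t) /=.
  by rewrite -tz mem_block ?tA // (subsetP sAS).
have iA : #|block S @: A| = #|A|.
  apply: card_in_imset => s t sA tA st.
  have: t \in block S s by rewrite st mem_block ?(subsetP sAS).
  move: sA tA; rewrite !inE => /andP[sS exs] /andP[_ ext] /andP[_ cst].
  exact: (acyclic_uniq e_sym e_acyclic cst sS xS exs ext).
have blD z : z \in D -> block (x |: S) z = block S z.
  rewrite inE => /andP[zS dz]; apply/setP=> t; apply/idP/idP; last first.
    by rewrite !inE => /andP[-> zt]; rewrite orbT (connect_induced_sub sSx).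
  rewrite inE => /andP[_ zt].
  apply: (connect_ind (P := fun t => t \in block S z) zt).
    exact: mem_block.
  move=> s r sz /and3P[_ rS esr].
  have := sz; rewrite inE => /andP[sS zs].
  case/setU1P: rS => [rx|rS].
    move/pred0P: dz => /(_ s) /=.
    by rewrite sz inE sS -rx e_sym esr.
  rewrite inE rS; apply: connect_trans zs _.
  by apply: connect1; rewrite /induced /= sS rS.
have blA z : z \in S -> z \notin D -> block (x |: S) z = block (x |: S) x.
  rewrite inE => zS; rewrite zS => /pred0Pn[t /andP[/= tz tA]].
  apply: block_eq; move: tz tA; rewrite !inE => /andP[tS zt] /andP[_ ext].
  apply: connect_trans (connect_induced_sub sSx zt) _.
  by apply: connect1; rewrite /induced /= !inE tS eqxx orbT e_sym.
have cx : components e (x |: S) = block (x |: S) x |: block S @: D.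
  rewrite componentsE imsetU1; apply/setP=> K; apply/setU1P/setU1P.
    case=> [->|/imsetP[z zS ->]]; first by left.
    case: (boolP (z \in D)) => zD; last by left; apply: blA.
    by right; rewrite blD // imset_f.
  case=> [->|/imsetP[z zD ->]]; first by left.
  right; rewrite -blD // imset_f //.
  by move: zD; rewrite inE => /andP[].
have xD : block (x |: S) x \notin block S @: D.
  apply/imsetP=> -[z _ xz]; have := mem_block (setU11 x S).
  by rewrite xz inE (negbTE xS).
(* If [m] components of [S] miss [A], then [S] has [#|A| + m] components and [x |: S] has
   [1 + m]. *)
move: dS; rewrite -leq_card_setU => /eqP dS.
rewrite cx cardsU1 xD cS dS iA !oddD /=.
by case: (odd #|A|); case: (odd _).
Qed.

Lemma components0 : components e set0 = set0.
Proof. by rewrite componentsE imset0. Qed.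

End Components.

(** * Moves as transvections of the adjacency form *)

Section Moves.

Variables (V : finType) (e : rel V).
Hypotheses (e_sym : symmetric e) (e_irr : irreflexive e).

Definition nbsum (a : labeling V) (i : V) : 'Z_2 := \sum_(k | e i k) a k.

Definition vertex_labeling (i : V) : labeling V := [ffun j => (j == i)%:R].

Local Notation dl := vertex_labeling.

Lemma nbsumD a b i : nbsum (a + b) i = nbsum a i + nbsum b i.
Proof. by rewrite -big_split; apply: eq_bigr => k _; rewrite ffunE. Qed.

Lemma nbsum_dl j i : nbsum (dl j) i = (e i j)%:R.
Proof.
rewrite /nbsum; case: (boolP (e i j)) => eij.
  rewrite (bigD1 j) //= ffunE eqxx big1 ?addr0 // => k /andP[_ /negbTE kj].
  by rewrite ffunE kj.
by apply: big1 => k eik; rewrite ffunE; case: eqP => // kj; rewrite -kj eik in eij.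
Qed.

Lemma moveE i a : move e i a = if nbsum a i == 1 then a + dl i else a.
Proof.
apply/ffunP=> j; rewrite ffunE -/(nbsum a i).
case: (Z2_cases (nbsum a i)) => -> /=; rewrite ?ffunE ?addr0;
  by case: eqP => [->|] //=; rewrite addr0.
Qed.

Lemma moveK i : involutive (move e i).
Proof.
move=> a; rewrite 2!moveE; case: (boolP (nbsum a i == 1)) => [a1|/negbTE->//].
by rewrite nbsumD nbsum_dl e_irr addr0 a1 -addrA labeling_addxx addr0.
Qed.

Lemma nbsum_move_id i a : nbsum (move e i a) i = nbsum a i.
Proof. by rewrite moveE; case: ifP => // _; rewrite nbsumD nbsum_dl e_irr addr0. Qed.

Lemma move_neq i a j : j != i -> move e i a j = a j.
Proof. by move=> /negbTE ji; rewrite ffunE ji. Qed.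

Lemma equiv_move i a : equiv e a (move e i a).
Proof. by apply/connect1/existsP; exists i. Qed.

Lemma equiv_dl i a : nbsum a i = 1 -> equiv e a (a + dl i).
Proof. by move=> ai; have := equiv_move i a; rewrite moveE ai eqxx. Qed.

Lemma equiv_sym : connect_sym (one_move e).
Proof.
apply: sym_connect_sym => a b; apply/existsP/existsP=> -[i /eqP->];
  by exists i; rewrite moveK.
Qed.

Lemma fixedP a : reflect (forall i, nbsum a i = 0) (fixed e a).
Proof.
apply: (iffP forallP) => [fa i|fa i]; last by rewrite moveE fa.
case: (Z2_cases (nbsum a i)) => // a1; have /eqP := fa i.
rewrite moveE a1 eqxx -[RHS]addr0 => /addrI /ffunP/(_ i).
by rewrite !ffunE eqxx.
Qed.

Lemma nonfixedP a : reflect (exists i, nbsum a i = 1) (~~ fixed e a).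
Proof.
apply: (iffP idP) => [|[i ai]]; last first.
  by apply/negP=> /fixedP/(_ i); rewrite ai.
rewrite negb_forall => /existsP[i]; rewrite moveE.
by case: (nbsum a i =P 1) => [ai _|_]; [exists i | rewrite eqxx].
Qed.

Lemma fixed_equiv a b : fixed e a -> equiv e a b -> b = a.
Proof.
move=> fa ab; apply: (connect_ind (P := fun c => c = a) ab) => //.
by move=> _ c -> /existsP[i /eqP->]; apply/eqP; apply: (forallP fa).
Qed.

Lemma equiv_fixed a b : equiv e a b -> fixed e a = fixed e b.
Proof.
move=> ab; have ba : equiv e b a by rewrite /equiv equiv_sym.
apply/idP/idP=> f; first by rewrite (fixed_equiv f ab).
by rewrite (fixed_equiv f ba).
Qed.

(** The bilinear form [B] whose Gram matrix on the basis [vertex_labeling] is the adjacency matrix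
    mod 2. *)
Definition labform (a b : labeling V) : 'Z_2 := \sum_i a i * nbsum b i.

Lemma labformDl a b c : labform (a + b) c = labform a c + labform b c.
Proof. by rewrite -big_split; apply: eq_bigr => i _; rewrite ffunE mulrDl. Qed.

Lemma labformC a b : labform a b = labform b a.
Proof.
have E c d : labform c d = \sum_i \sum_j (e i j)%:R * (c i * d j).
  apply: eq_bigr => i _; rewrite big_distrr /= big_mkcond.
  by apply: eq_bigr => j _; case: (e i j); rewrite ?mul1r ?mul0r.
rewrite !E exchange_big; apply: eq_bigr => i _; apply: eq_bigr => j _.
by rewrite e_sym [b i * _]mulrC.
Qed.

Lemma labformDr a b c : labform a (b + c) = labform a b + labform a c.
Proof. by rewrite ![labform a _]labformC labformDl. Qed.

Lemma labform_dl a i : labform a (dl i) = nbsum a i.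
Proof.
rewrite labformC /labform (bigD1 i) //= ffunE eqxx mul1r big1 ?addr0 //.
by move=> j /negbTE ji; rewrite ffunE ji mul0r.
Qed.

(** The vector [d] is isotropic and its transvection is realised by moves. The sequence of moves may
    depend on the labeling [a]. *)
Definition transvects (d : labeling V) : Prop :=
  labform d d = 0 /\ forall a, labform a d = 1 -> equiv e a (a + d).

Lemma transvects_dl i : transvects (dl i).
Proof.
split=> [|a]; first by rewrite labform_dl nbsum_dl e_irr.
by rewrite labform_dl => /equiv_dl.
Qed.

(** If [B(a, c + d) = 1], exactly one of [B(a, c)] and [B(a, d)] is 1. Adding that vector first
    makes the pairing with the other one 1 as well, because [B(c, d) = 1]. *)
Lemma transvectsD c d :
  transvects c -> transvects d -> labform c d = 1 -> transvects (c + d).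
Proof.
move=> [cc tc] [dd td] cd; have dc : labform d c = 1 by rewrite labformC.
split=> [|a]; first by rewrite labformDl !labformDr cc dd cd dc; apply: val_inj.
rewrite labformDr.
case: (Z2_cases (labform a c)) => ac; rewrite ac => ad.
  rewrite add0r in ad; rewrite [c + d]addrC addrA.
  apply: connect_trans (td a ad) (tc _ _).
  by rewrite labformDl ac dc add0r.
rewrite addrA; apply: connect_trans (tc a ac) (td _ _).
by rewrite labformDl cd addrC.
Qed.

Lemma transvects_move i d : transvects d -> transvects (move e i d).
Proof.
move=> td; rewrite moveE; case: eqP => // di.
by apply: transvectsD => //; [apply: transvects_dl | rewrite labform_dl].
Qed.

(** * Sequences of moves at the vertices of a given set *)

Section Restricted.

Variable S : {set V}.

Definition equiv_in : rel (labeling V) :=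
  connect [rel a b | [exists i in S, b == move e i a]].

Lemma equiv_in_ind (P : labeling V -> Prop) a b : equiv_in a b ->
  P a -> (forall c i, i \in S -> P c -> P (move e i c)) -> P b.
Proof.
move=> ab Pa Pm; apply: (connect_ind (P := P) ab Pa) => c d Pc.
by case/exists_inP=> i iS /eqP->; apply: Pm.
Qed.

Lemma equiv_in_move a b i : i \in S -> equiv_in a b -> equiv_in a (move e i b).
Proof.
move=> iS ab; apply: connect_trans ab (connect1 _).
by apply/exists_inP; exists i.
Qed.

Lemma equiv_inW a b : equiv_in a b -> equiv e a b.
Proof.
move=> ab; apply: (equiv_in_ind (P := equiv e a) ab); first exact: connect0.
by move=> c i _ ac; apply: connect_trans ac (equiv_move i c).
Qed.

Lemma equiv_in_out a b j : equiv_in a b -> j \notin S -> b j = a j.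
Proof.
move=> ab jS; apply: (equiv_in_ind (P := fun c => c j = a j) ab) => //.
move=> c i iS <-; rewrite move_neq //.
by apply: contraNneq jS => ->.
Qed.

(* If the neighbour sum at [y] vanished on the whole orbit of [a], then it
   would also vanish at each neighbour [z] of [y], as flipping [z] changes the
   neighbour sum at [y]; this propagates to [i]. *)
Lemma equiv_in_nbsum1 a y i : connected_set e S -> y \in S -> i \in S ->
  nbsum a i = 1 -> exists2 b, equiv_in a b & nbsum b y = 1.
Proof.
move=> Sc yS iS ai.
case: (boolP [exists b, equiv_in a b && (nbsum b y == 1)]).
  by case/existsP=> b /andP[ab /eqP]; exists b.
rewrite negb_exists => /forallP b0.
suff /(_ a (connect0 _ _)) : forall b, equiv_in a b -> nbsum b i = 0 by rewrite ai.
apply: (connect_ind (P := fun z => forall b, equiv_in a b -> nbsum b z = 0)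
  (Sc y i yS iS)).
  by move=> b ab; have := b0 b; rewrite ab /= Z2_neq1 => /eqP.
move=> z t z0 /and3P[_ tS ezt] b ab.
case: (Z2_cases (nbsum b t)) => // b1.
have := z0 _ (equiv_in_move tS ab); rewrite moveE b1 eqxx nbsumD z0 // add0r.
by rewrite nbsum_dl ezt.
Qed.

End Restricted.

End Moves.

Notation dl := vertex_labeling.

(** * Invariance of the parity of the number of components *)

Section Parity.

Variables (V : finType) (e : rel V).
Hypotheses (e_sym : symmetric e) (e_irr : irreflexive e).
Hypothesis e_acyclic : acyclic_graph e.

Lemma nbsum_odd (a : labeling V) i :
  nbsum e a i = (odd #|[set k in [set k | a k == 1] | e i k]|)%:R.
Proof.
rewrite -Z2_natr /nbsum big_mkcond /= -sum1_card natr_sum [RHS]big_mkcond /=.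
apply: eq_bigr => k _; rewrite !inE.
by case: (e i k); case: (Z2_cases (a k)) => ->.
Qed.

Lemma odd_num_components_dl (a : labeling V) i : a i = 0 -> nbsum e a i = 1 ->
  odd (num_components e (a + dl i)) = odd (num_components e a).
Proof.
move=> ai0 ai; rewrite /num_components.
have -> : [set k | (a + dl i) k == 1] = i |: [set k | a k == 1].
  apply/setP=> k; rewrite !inE !ffunE.
  by case: (k =P i) => [->|_]; rewrite ?ai0 ?addr0.
rewrite odd_components_setU1 ?inE ?ai0 //.
have := ai; rewrite nbsum_odd; case: (odd #|_|) => //.
by rewrite addbF.
Qed.

Lemma odd_num_components_equiv a b : equiv e a b ->
  odd (num_components e a) = odd (num_components e b).
Proof.
move=> ab; pose P c := odd (num_components e a) = odd (num_components e c).
apply: (connect_ind (P := P) ab) => //; rewrite /P => c _ -> /existsP[i /eqP->].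
rewrite moveE; case: eqP => // c1.
(* If [c i = 1], the move switches [i] off; the previous lemma applies to the same move read
   backwards, from [c + dl i] to [c]. *)
case: (Z2_cases (c i)) => ci; first by rewrite odd_num_components_dl.
rewrite -(odd_num_components_dl (a := c + dl i) (i := i)).
- by rewrite -addrA labeling_addxx addr0.
- by rewrite !ffunE ci eqxx; apply: val_inj.
by rewrite nbsumD nbsum_dl e_irr addr0.
Qed.

Lemma dl_support (i : V) : [set k | dl i k == 1] = [set i].
Proof. by apply/setP=> k; rewrite !inE ffunE; case: (k =P i). Qed.

Lemma odd_num_components_vertex (i : V) : odd (num_components e (dl i)).
Proof.
rewrite /num_components dl_support -[X in components e X]setU0.
rewrite odd_components_setU1 ?inE // components0 cards0 /=.
by rewrite (eq_card0 (A := [set _ in _ | _])) // => k; rewrite !inE.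
Qed.

Lemma odd_num_components_pair (i j : V) : i != j -> ~~ e i j ->
  ~~ odd (num_components e (dl i + dl j)).
Proof.
move=> ij eij; rewrite /num_components.
have -> : [set k | (dl i + dl j) k == 1] = i |: [set j].
  apply/setP=> k; rewrite !inE !ffunE; case: (k =P i) => [->|_] /=.
    by rewrite (negbTE ij) addr0.
  by rewrite add0r; case: (k =P j).
rewrite odd_components_setU1 ?inE //.
have := odd_num_components_vertex j; rewrite /num_components dl_support => ->.
rewrite (eq_card0 (A := [set _ in _ | _])) // => k; rewrite !inE.
by case: eqP => // ->; rewrite (negbTE eij).
Qed.

End Parity.

(** * The finite computation on E6 *)

(* The vertices of E6 are numbered in the order [v, w1, u1, w2, u2, w3]: the
   centre [v] with arms [w1 - u1], [w2 - u2] and [w3]. *)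
Definition E6_nbrs : seq (seq nat) :=
  [:: [:: 1; 3; 5]; [:: 0; 2]; [:: 1]; [:: 0; 4]; [:: 3]; [:: 0]]%N.

Definition E6_move (k : nat) (t : bitseq) : bitseq :=
  [seq nth false t j
       (+) ((j == k) && foldr addb false
              [seq nth false t l | l <- nth [::] E6_nbrs k]) | j <- iota 0 6].

Fixpoint bitseqs (n : nat) : seq bitseq :=
  if n is m.+1 then map (cons false) (bitseqs m) ++ map (cons true) (bitseqs m)
  else [:: [::]].

(** The search runs backwards from the targets, so that membership yields moves leading from a
    labeling to a target. *)
Definition E6_step (r : seq bitseq) : seq bitseq :=
  r ++ [seq t <- bitseqs 6 | has (fun k => E6_move k t \in r) (iota 0 6)].

(** The two seeds encode [dl v] and [dl w1 + dl w2], with one and two components. *)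
Definition E6_reach (n : nat) : seq bitseq :=
  iter n E6_step [:: [:: true; false; false; false; false; false];
                     [:: false; true; false; true; false; false]].

Lemma E6_reachS n t : t \in E6_reach n.+1 ->
  t \in E6_reach n \/ exists2 k, (k < 6)%N & E6_move k t \in E6_reach n.
Proof.
rewrite /E6_reach iterS {1}/E6_step mem_cat mem_filter.
case/orP=> [|/andP[/hasP[k k6 tk] _]]; [by left | right].
by exists k; rewrite // mem_iota in k6.
Qed.

Lemma mem_bitseqs t : t \in bitseqs (size t).
Proof.
elim: t => //= b t IHt; rewrite mem_cat.
by case: b; rewrite map_f ?orbT.
Qed.

(** Twelve rounds of the search suffice to collect all 63 nonzero codes. *)
Lemma E6_reach_nonzero :
  let r := E6_reach 12 in
  all (fun t => (t == nseq 6 false) || (t \in r)) (bitseqs 6).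
Proof. by vm_compute. Qed.

Definition supported (V : finType) (S : {set V}) (a : labeling V) : Prop :=
  forall x, x \notin S -> a x = 0.

(** * An E6 inside a forest and its labelings *)

Section E6.

Variables (V : finType) (e : rel V).
Hypotheses (e_sym : symmetric e) (e_irr : irreflexive e).
Hypothesis e_acyclic : acyclic_graph e.

Lemma nbr_notadj (v w w' : V) : e v w -> e v w' -> e w w' = false.
Proof.
move=> vw vw'; apply/negP=> ww'.
have Sc : connected_set e [set w; v].
  apply: (connected_setU1 e_sym (@connected_set1 _ e v) (set11 v)).
  by rewrite e_sym.
have w'S : w' \notin [set w; v].
  by rewrite !inE; apply/norP; split; apply/eqP=> w'E;
    rewrite w'E e_irr in ww' vw'.
have := acyclic_nbr e_sym e_acyclic Sc w'S (set22 w v).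
rewrite e_sym vw' => /(_ isT w (set21 w v)); rewrite e_sym ww' => /esym/eqP wv.
by rewrite wv e_irr in vw.
Qed.

(** Otherwise [v], [w], [u], [w'] would form a 4-cycle. *)
Lemma nbr_nbr_notadj (v w w' u : V) :
  e v w -> e v w' -> w != w' -> u != v -> e w u -> e w' u = false.
Proof.
move=> vw vw' ww' uv wu; apply/negP=> w'u.
have Sc : connected_set e (w |: [set w'; v]).
  apply: (connected_setU1 (y := v) e_sym); rewrite ?set22 1?e_sym //.
  apply: (connected_setU1 e_sym (@connected_set1 _ e v) (set11 v)).
  by rewrite e_sym.
have uS : u \notin w |: [set w'; v].
  rewrite !inE (negbTE uv) orbF; apply/norP; split; apply/eqP=> uE.
    by rewrite uE e_irr in wu.
  by rewrite uE e_irr in w'u.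
have := acyclic_nbr e_sym e_acyclic Sc uS (setU11 _ _).
rewrite e_sym wu => /(_ isT w'); rewrite !inE eqxx orbT e_sym w'u.
by move/(_ isT)/esym/eqP=> E; rewrite E eqxx in ww'.
Qed.

Variables v w1 w2 w3 u1 u2 : V.
Hypotheses (vw1 : e v w1) (vw2 : e v w2) (vw3 : e v w3).
Hypotheses (w12 : w1 != w2) (w13 : w1 != w3) (w23 : w2 != w3).
Hypotheses (wu1 : e w1 u1) (wu2 : e w2 u2) (u1v : u1 != v) (u2v : u2 != v).

Definition reducible (a : labeling V) : Prop :=
  equiv e a (dl v) \/ equiv e a (dl w1 + dl w2).

Lemma reducible_equiv a b : equiv e a b -> reducible b -> reducible a.
Proof. by move=> ab [] bc; [left|right]; apply: connect_trans ab bc. Qed.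

Let s : seq V := [:: v; w1; u1; w2; u2; w3].
Let S0 : {set V} := [set:: s].

Lemma E6_edges : forall i j, (i < 6)%N -> (j < 6)%N ->
  e (nth v s i) (nth v s j) = (j \in nth [::] E6_nbrs i).
Proof.
have vu1 : e v u1 = false.
  by apply/negP=> /(nbr_notadj vw1); rewrite wu1.
have vu2 : e v u2 = false.
  by apply/negP=> /(nbr_notadj vw2); rewrite wu2.
have w2u1 : e w2 u1 = false by apply: (nbr_nbr_notadj vw1 vw2).
have w3u1 : e w3 u1 = false by apply: (nbr_nbr_notadj vw1 vw3).
have w1u2 : e w1 u2 = false.
  by apply: (nbr_nbr_notadj vw2 vw1) => //; rewrite eq_sym.
have w3u2 : e w3 u2 = false by apply: (nbr_nbr_notadj vw2 vw3).
(* An edge between [u1] and [u2] would close the pentagon [v], [w1], [u1], [u2], [w2]. *)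
have u12 : e u1 u2 = false.
  apply/negP=> u12.
  have Sc : connected_set e (u2 |: (w2 |: [set w1; v])).
    apply: (connected_setU1 (y := w2) e_sym); rewrite ?setU11 1?e_sym //.
    apply: (connected_setU1 (y := v) e_sym); rewrite ?set22 1?e_sym //.
    apply: (connected_setU1 e_sym (@connected_set1 _ e v) (set11 v)).
    by rewrite e_sym.
  have u1S : u1 \notin u2 |: (w2 |: [set w1; v]).
    rewrite !inE (negbTE u1v) orbF; apply/norP; split; [|apply/norP; split];
      apply/eqP=> uE.
    - by rewrite uE e_irr in u12.
    - by move: wu1; rewrite uE (nbr_notadj vw1 vw2).
    - by move: wu1; rewrite uE e_irr.
  have := acyclic_nbr e_sym e_acyclic Sc u1S (setU11 _ _) u12.
  move/(_ w1); rewrite !inE eqxx !orbT e_sym wu1 => /(_ isT)/esym/eqP w1u2E.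
  by rewrite -w1u2E vw1 in vu2.
have E x y b : e x y = b -> (e x y = b) * (e y x = b) by rewrite [e y x]e_sym.
have tab := (E _ _ _ vw1, E _ _ _ vw2, E _ _ _ vw3, E _ _ _ wu1, E _ _ _ wu2,
  E _ _ _ vu1, E _ _ _ vu2, (E _ _ _ w2u1, E _ _ _ w3u1, E _ _ _ w1u2,
  E _ _ _ w3u2, E _ _ _ u12, E _ _ _ (nbr_notadj vw1 vw2),
  E _ _ _ (nbr_notadj vw1 vw3), E _ _ _ (nbr_notadj vw2 vw3)), e_irr).
by do 6?[case=> [|]]; try (by []); do 6?[case=> [|]]; try (by []);
  move=> _ _; rewrite /= tab.
Qed.

Lemma E6_uniq : uniq s.
Proof.
apply/(uniqP v) => i j; rewrite !inE /= => i6 j6 ij.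
pose same i j := all
  (fun k => (k \in nth [::] E6_nbrs i) == (k \in nth [::] E6_nbrs j)) (iota 0 6).
have same_eq : all (fun i => all (fun j => same i j ==> (i == j)) (iota 0 6))
  (iota 0 6) by vm_compute.
have i_in : i \in iota 0 6 by rewrite mem_iota.
have j_in : j \in iota 0 6 by rewrite mem_iota.
apply/eqP; apply: (implyP (allP (allP same_eq _ i_in) _ j_in)).
apply/allP=> k; rewrite mem_iota /= => k6.
by rewrite -!E6_edges // ij.
Qed.

Definition E6_code (a : labeling V) : bitseq := [seq a x == 1 | x <- s].

Lemma mem_S0 k : (k < 6)%N -> nth v s k \in S0.
Proof. by move=> k6; rewrite inE mem_nth. Qed.

Lemma nbsum_S0 (a : labeling V) k : supported S0 a -> (k < 6)%N ->
  nbsum e a (nth v s k) =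
    \sum_(l <- nth [::] E6_nbrs k) a (nth v s l).
Proof.
move=> a0 k6; rewrite /nbsum.
have -> : \sum_(x | e (nth v s k) x) a x = \sum_(x <- s | e (nth v s k) x) a x.
  transitivity (\sum_(x in S0 | e (nth v s k) x) a x).
    rewrite (bigID (mem S0)) /= addrC big1 ?add0r.
      by apply: eq_bigl => x; rewrite andbC.
    by move=> x /andP[_ xS]; apply: a0.
  rewrite -[RHS]big_filter [RHS]big_uniq ?filter_uniq ?E6_uniq //.
  by apply: eq_bigl => x; rewrite mem_filter inE andbC.
rewrite (big_nth v) big_mkord big_mkcond /=.
under eq_bigr => i _ do rewrite E6_edges //.
rewrite !big_ord_recr big_ord0 /= !add0r.
by case: k k6 => [|[|[|[|[|[|k]]]]]] //= _;
  rewrite ?big_cons ?big_nil ?addr0 ?add0r ?addrA.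
Qed.

Lemma E6_code_move (a : labeling V) k : supported S0 a -> (k < 6)%N ->
  E6_code (move e (nth v s k) a) = E6_move k (E6_code a).
Proof.
move=> a0 k6; apply: (@eq_from_nth _ false); first by rewrite !size_map size_iota.
move=> j; rewrite size_map /= => j6.
rewrite (nth_map v) // (nth_map 0%N) ?size_iota // nth_iota // add0n.
rewrite ffunE nth_uniq ?E6_uniq // -/(nbsum _ _ _) nbsum_S0 //.
have xorE (x y : 'Z_2) : (x + y == 1) = (x == 1) (+) (y == 1).
  by case: (Z2_cases x) => ->; case: (Z2_cases y) => ->.
case: (j =P k) => [->|_] /=; last first.
  by rewrite addbF (nth_map v).
rewrite xorE (nth_map v) //; congr (_ (+) _).
have : all (fun l => (l < 6)%N) (nth [::] E6_nbrs k).
  by move: k6; do 6?[case: k => [|k]].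
elim: (nth _ _ _) => [_|l r IHr /= /andP[l6 /IHr IH]]; first by rewrite big_nil.
by rewrite big_cons xorE IH (nth_map v).
Qed.

Lemma E6_code_inj (a b : labeling V) : supported S0 a -> supported S0 b ->
  E6_code a = E6_code b -> a = b.
Proof.
move=> a0 b0 ab; apply/ffunP=> x.
case: (boolP (x \in S0)) => xS; last by rewrite a0 ?b0.
have xs : x \in s by rewrite inE in xS.
have := congr1 (fun t => nth false t (index x s)) ab.
rewrite !(nth_map v) ?index_mem // nth_index //.
by case: (Z2_cases (a x)) => ->; case: (Z2_cases (b x)) => ->.
Qed.

Lemma dl_S0 k : (k < 6)%N -> supported S0 (dl (nth v s k)).
Proof.
move=> k6 x xS; rewrite ffunE; case: eqP => // xk.
by rewrite xk mem_S0 in xS.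
Qed.

(** Each round of the search accounts for one move; after undoing all of them the code is a seed,
    and a supported labeling is determined by its code. *)
Lemma E6_reach_reducible n a : supported S0 a ->
  E6_code a \in E6_reach n -> reducible a.
Proof.
elim: n a => [|n IHn] a a0; last first.
  case/E6_reachS => [|[k k6]]; first exact: IHn; rewrite -E6_code_move // => ak.
  apply: reducible_equiv (equiv_move e (nth v s k) a) _; apply: IHn ak.
  move=> x x0; rewrite move_neq ?a0 //; apply: contraNneq x0 => ->.
  exact: mem_S0.
have codes i : (i < 6)%N -> E6_code (dl (nth v s i)) = [seq j == i | j <- iota 0 6].
  move=> i6; apply: (@eq_from_nth _ false); first by rewrite !size_map.
  move=> j; rewrite size_map => j6; rewrite (nth_map v) //.
  rewrite (nth_map 0%N) ?size_iota // nth_iota // ffunE nth_uniq ?E6_uniq //.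
  by case: (j =P i).
rewrite !inE => /orP[] /eqP aE; [left|right].
  suff -> : a = dl (nth v s 0) by apply: connect0.
  by apply: E6_code_inj; rewrite ?codes //; apply: dl_S0.
suff -> : a = dl (nth v s 1) + dl (nth v s 3) by apply: connect0.
apply: E6_code_inj => //.
  by move=> x x0; rewrite ffunE !(dl_S0 _ x0) // addr0.
rewrite aE; apply: (@eq_from_nth _ false); first by rewrite size_map.
move=> j j6; rewrite (nth_map v) // !ffunE !(@nth_uniq _ v s) ?E6_uniq //.
by do 6?[case: j j6 => [|j] j6].
Qed.

(** The vertex [i] witnesses that [a] is outside the radical of the form restricted to [S]. Only the
    support is confined to [S]: the moves behind [reducible] may use any vertex of the graph. *)
Definition reduces (S : {set V}) : Prop := forall a : labeling V,
  supported S a -> (exists2 i, i \in S & nbsum e a i = 1) -> reducible a.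

Lemma E6_reduces : reduces S0.
Proof.
move=> a a0 [i iS ai]; apply: (@E6_reach_reducible 12 a a0).
have := allP E6_reach_nonzero _ (mem_bitseqs (E6_code a)).
case/orP=> // /eqP aE; suff a_0 : a = 0.
  by move: ai; rewrite a_0 /nbsum big1 // => k _; rewrite ffunE.
apply: E6_code_inj => //; first by move=> x _; rewrite ffunE.
by rewrite aE /E6_code /= !ffunE.
Qed.

(** * Growing the tree from E6 by leaves *)

Lemma S0_sub_nbrs (S : {set V}) : S0 \subset S ->
  [/\ v \in S, w1 \in S, w2 \in S, w3 \in S & u1 \in S /\ u2 \in S].
Proof.
move=> /subsetP sub; have m k : (k < 6)%N -> nth v s k \in S.
  by move=> k6; apply/sub/mem_S0.
split; [exact: (m 0%N) | exact: (m 1%N) | exact: (m 3%N) | exact: (m 5%N)|].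
by split; [exact: (m 2%N) | exact: (m 4%N)].
Qed.

(* [P] will say that a vertex lies on the same side of [v] as a given one. *)
Lemma E6_far_pair (P : pred V) :
    (forall w w', e v w -> e v w' -> P w -> P w' -> w = w') ->
  exists wa wb ua,
    [/\ ~~ P wa, ~~ P wb, wa != wb, e v wa /\ e v wb & e wa ua /\ ua != v]
    /\ [/\ wa \in S0, wb \in S0 & ua \in S0].
Proof.
move=> P1; have [v0 w10 w20 w30 [u10 u20]] := S0_sub_nbrs (subxx S0).
case: (boolP (P w1)) => Pw1.
  exists w2, w3, u2; split; split=> //.
    by apply: contraNN w12 => Pw; apply/eqP/P1.
  by apply: contraNN w13 => Pw; apply/eqP/P1.
case: (boolP (P w2)) => Pw2; last by exists w1, w2, u1.
exists w1, w3, u1; split; split=> //.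
by apply: contraNN w23 => Pw; apply/eqP/P1.
Qed.

(** The labeling [b] is obtained from [dl v] by moves in the component [U] of [y] in [S] without
    [v], hence inherits [transvects]. The vertices [wa] and [wb] are neighbours of [v] outside [U],
    and [ua] is adjacent to only one of them, which later detects a labeling outside the radical. *)
Lemma transvection_branch (S : {set V}) y :
    connected_set e S -> S0 \subset S -> y \in S ->
  exists wa wb ua b,
    [/\ wa \in S, wb \in S, ua \in S, wa != y & wb != y] /\
    [/\ e wa ua, e wb ua = false, e wa wb = false, supported S b
      & [/\ transvects e b, b y = 1, nbsum e b wa = 1 & nbsum e b wb = 1]].
Proof.
move=> Sc sub yS; have [vS _ _ _ _] := S0_sub_nbrs sub.
have geo wa wb ua : e v wa /\ e v wb -> wa != wb -> e wa ua /\ ua != v ->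
    e wb ua = false /\ e wa wb = false.
  move=> [va vb] ab [au uv]; split; last exact: nbr_notadj va vb.
  exact: nbr_nbr_notadj va vb ab uv au.
(* For [y = v] there is no branch to traverse, and [b = dl v] works. *)
have [->|yv] := eqVneq y v.
  have [wa [wb [ua [[_ _ ab vab au] [aS bS uS]]]]] :=
    @E6_far_pair pred0 (fun w w' _ _ f => False_ind _ (notF f)).
  have [g1 g2] := geo _ _ _ vab ab au; case: vab au => [va vb] [au uv].
  have nv w : e v w -> w != v.
    by move=> vw; apply: contraTneq vw => ->; rewrite e_irr.
  exists wa, wb, ua, (dl v); split; first by split; rewrite ?(subsetP sub) ?nv.
  split=> //.
    by move=> x xS; rewrite ffunE; case: (x =P v) => // xv; rewrite xv vS in xS.
  split; first exact: transvects_dl.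
  - by rewrite ffunE eqxx.
  - by rewrite nbsum_dl e_sym va.
  by rewrite nbsum_dl e_sym vb.
pose U := block e (S :\ v) y.
have ySv : y \in S :\ v by rewrite !inE yv.
have yU : y \in U by apply: mem_block.
have U_S : U \subset S.
  by apply/subsetP=> z; rewrite !inE => /andP[/andP[]].
have vU : v \notin U by rewrite !inE eqxx.
have Uadj z t : z \in U -> t \in S -> t != v -> e z t -> t \in U.
  move=> zU tS tv zt; move: zU; rewrite !inE tS tv /= => /andP[/andP[zv zS] yz].
  apply: connect_trans yz (connect1 _).
  by rewrite /induced /= !inE zv zS tv tS.
have Uc : connected_set e U.
  have yto z : z \in U -> connect (induced e U) y z.
    rewrite {1}inE => /andP[_ yz].
    apply: (proj2 (A := z \in U)).
    apply: (connect_ind (P := fun t => t \in U /\ connect (induced e U) y t) yz).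
      by [].
    move=> t r [tU yt] /and3P[_ + tr]; rewrite in_setD1 => /andP[rv rS].
    have rU := Uadj t r tU rS rv tr; split=> //.
    by apply: connect_trans yt (connect1 _); rewrite /induced /= tU rU.
  move=> z t zU tU; apply: connect_trans (yto t tU).
  by rewrite connect_induced_sym // yto.
have [p pU vp] : exists2 p, p \in U & e v p.
  have : v \in U \/ exists2 p, p \in U & e v p.
    apply: (connect_ind (P := fun t => t \in U \/ exists2 p, p \in U & e v p)
      (Sc y v yS vS)); first by left.
    move=> z t [zU|]; last by right.
    case/and3P=> _ tS zt; have [tv|tv] := eqVneq t v.
      by right; exists z; rewrite // -tv e_sym.
    by left; apply: Uadj zU tS tv zt.
  by case=> [vU'|//]; rewrite vU' in vU.
(* In a forest [v] has at most one neighbour in the connected set [U], so [mem U] satisfies the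
   hypothesis on [P]. *)
have [//|wa [wb [ua [[aU bU ab vab au] [aS bS uS]]]]] := @E6_far_pair (mem U).
  move=> w w' vw vw' wU w'U.
  exact: (acyclic_uniq e_sym e_acyclic (Uc w w' wU w'U) wU vU vw vw').
have [g1 g2] := geo _ _ _ vab ab au; case: vab au => [va vb] [au uv].
have nv w : e v w -> w != v.
  by move=> vw; apply: contraTneq vw => ->; rewrite e_irr.
have [b0 vb0 b0y] : exists2 b, equiv_in e U (dl v) b & nbsum e b y = 1.
  by apply: (equiv_in_nbsum1 (i := p)) => //; rewrite nbsum_dl e_sym vp.
(* If [y] is still labeled 0, its neighbour sum 1 lets one more move switch it on. *)
have [b vb_b by1] : exists2 b, equiv_in e U (dl v) b & b y = 1.
  case: (Z2_cases (b0 y)) => b0y1; last by exists b0.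
  exists (move e y b0); first exact: equiv_in_move.
  by rewrite moveE b0y eqxx !ffunE b0y1 eqxx add0r.
(* A neighbour of [v] in [S] outside [U] has no neighbour in [U], so moves in [U] preserve its
   initial neighbour sum 1, which comes from [v]. *)
have nbw w : e v w -> w \in S -> w \notin U -> nbsum e b w = 1.
  move=> vw wS wU.
  apply: (equiv_in_ind (P := fun c => nbsum e c w = 1) vb_b).
    by rewrite nbsum_dl e_sym vw.
  move=> c i iU cw; rewrite moveE; case: eqP => // _.
  rewrite nbsumD cw nbsum_dl; case: (boolP (e w i)) => wi; last by rewrite addr0.
  by rewrite (Uadj i w iU wS (nv w vw)) // e_sym in wU.
have sw := subsetP sub.
exists wa, wb, ua, b; split.
  split; rewrite ?sw //.
    by apply: contraNneq aU => ->.
  by apply: contraNneq bU => ->.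
split=> //.
  move=> x xS; rewrite (equiv_in_out vb_b).
    by rewrite ffunE; case: (x =P v) => // xv; rewrite xv vS in xS.
  by apply: contraNN xS; apply: (subsetP U_S).
split=> //; [|by rewrite nbw ?sw|by rewrite nbw ?sw].
apply: (equiv_in_ind (P := transvects e) vb_b); first exact: transvects_dl.
by move=> c i _; apply: transvects_move.
Qed.

Lemma reducesU1 (S : {set V}) x y :
  connected_set e S -> S0 \subset S -> x \notin S -> y \in S -> e x y -> reduces S -> reduces (x |: S).
Proof.
move=> Sc sub xS yS xy redS a aS [i iS ai].
have xnbr := acyclic_nbr e_sym e_acyclic Sc xS yS xy.
have xSc := connected_setU1 e_sym Sc yS xy.
have [c0 ac0 c0x] := equiv_in_nbsum1 xSc (setU11 x S) iS ai.
(* With neighbour sum 1 at [x], a move at [x] can clear its label; the result is supported on [S],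
   and [c y = 1] because [y] is the only neighbour of [x] in [S]. *)
have [c [ac cx cx0]] :
    exists c, [/\ equiv_in e (x |: S) a c, nbsum e c x = 1 & c x = 0].
  case: (Z2_cases (c0 x)) => c0x1; first by exists c0.
  exists (move e x c0); split; first by rewrite equiv_in_move ?setU11.
    by rewrite nbsum_move_id.
  by rewrite moveE c0x eqxx !ffunE c0x1 eqxx; apply: val_inj.
have cS : supported S c.
  move=> z zS; have [->//|zx] := eqVneq z x.
  have zxS : z \notin x |: S by rewrite !inE negb_or zx.
  by rewrite (equiv_in_out ac) ?aS.
have nbx d : supported S d -> nbsum e d x = d y.
  move=> dS; rewrite /nbsum (bigD1 y) //= big1 ?addr0 // => k /andP[xk ky].
  apply: dS; by apply: contraNN ky => kS; rewrite -xnbr.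
apply: reducible_equiv (equiv_inW ac) _.
case: (boolP [exists j in S, nbsum e c j == 1]) => [/exists_inP[j jS /eqP cj]|].
  by apply: redS => //; exists j.
rewrite negb_exists_in => /forall_inP c_rad.
have {}c_rad j : j \in S -> nbsum e c j = 0.
  by move=> jS; apply/eqP; rewrite -Z2_neq1 c_rad.
have [wa [wb [ua [b [[waS wbS uaS ay byy]]]]]] := transvection_branch Sc sub yS.
case=> au bu ab bS [tb by1 ba bb].
have ea : e x wa = false by rewrite xnbr // (negbTE ay).
have eb : e x wb = false by rewrite xnbr // (negbTE byy).
have [bb0 _] := tb.
have ta : transvects e (b + dl wa).
  by apply: transvectsD => //; [apply: transvects_dl | rewrite labform_dl //].
have tb' : transvects e (b + dl wb).
  by apply: transvectsD => //; [apply: transvects_dl | rewrite labform_dl //].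
have cb : labform e c b = 0.
  rewrite labformC // /labform big1 // => k _.
  case: (boolP (k \in S)) => kS; first by rewrite c_rad ?mulr0.
  by rewrite bS ?mul0r.
have xb : labform e (dl x) b = 1 by rewrite labformC // labform_dl // nbx.
(* Here [B(c, b)] and [B(c, w)] vanish since [c] is in the radical of [S], and [B(x, w) = 0]; what
   remains is [B(x, b) = b y = 1]. *)
have cxb w : w \in S -> e x w = false ->
    labform e (c + dl x) (b + dl w) = 1.
  move=> wS xw; rewrite labformDl !labformDr // cb xb !labform_dl // c_rad //.
  by rewrite nbsum_dl e_sym xw !addr0 add0r.
have step1 := equiv_dl cx.
have step2 := proj2 ta _ (cxb wa waS ea).
(* The pairing is [B(c + x, b + wb) = 1] plus [B(b + wa, b + wb) = 0 + 1 + 1 + 0], hence 1. *)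
have step3 : equiv e (c + dl x + (b + dl wa))
    (c + dl x + (b + dl wa) + (b + dl wb)).
  apply: (proj2 tb'); rewrite labformDl cxb // labformDl !labformDr //.
  rewrite !labform_dl // bb0 bb labformC // labform_dl // ba nbsum_dl e_sym ab.
  by apply: val_inj.
(* The two copies of [b] cancel, leaving only the two endpoints. *)
have Ed : c + dl x + (b + dl wa) + (b + dl wb) = c + dl wa + dl wb + dl x.
  apply/ffunP=> k; rewrite !ffunE.
  by case: (Z2_cases (c k)) => ->; case: (Z2_cases (b k)) => ->;
    case: (k == x); case: (k == wa); case: (k == wb); apply: val_inj.
rewrite Ed in step3.
(* Neither [wa] nor [wb] is adjacent to [x], so the neighbour sum at [x] is still 1 and [x] can be
   switched off. *)
have step4 : equiv e (c + dl wa + dl wb + dl x) (c + dl wa + dl wb).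
  rewrite -[X in equiv e _ X]addr0 -(labeling_addxx (dl x)) addrA.
  by apply: equiv_dl; rewrite !nbsumD !nbsum_dl cx ea eb e_irr !addr0.
apply: reducible_equiv (connect_trans step1 (connect_trans step2
  (connect_trans step3 step4))) _.
apply: redS.
  move=> z zS; rewrite !ffunE cS // add0r; case: eqP => [zw|_].
    by rewrite zw waS in zS.
  by case: eqP => [zw|_]; [rewrite zw wbS in zS | rewrite addr0].
(* At [ua] the labeling [c] contributes 0, [wa] contributes 1 and [wb] contributes 0. *)
exists ua => //; rewrite !nbsumD !nbsum_dl c_rad // !(e_sym ua) au bu.
by rewrite add0r addr0.
Qed.

Lemma S0_connected : connected_set e S0.
Proof.
have -> : S0 = u2 |: (u1 |: (w3 |: (w2 |: [set w1; v]))).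
  apply/setP=> x; rewrite !inE; case: (x == v); case: (x == w1); case: (x == u1);
    by case: (x == w2); case: (x == u2); case: (x == w3).
have c1 : connected_set e [set w1; v].
  apply: (connected_setU1 e_sym (@connected_set1 _ e v) (set11 v)).
  by rewrite e_sym.
have c2 : connected_set e (w2 |: [set w1; v]).
  by apply: (connected_setU1 (y := v) e_sym c1);
    [rewrite !inE eqxx orbT | rewrite e_sym].
have c3 : connected_set e (w3 |: (w2 |: [set w1; v])).
  by apply: (connected_setU1 (y := v) e_sym c2);
    [rewrite !inE eqxx !orbT | rewrite e_sym].
have c4 : connected_set e (u1 |: (w3 |: (w2 |: [set w1; v]))).
  by apply: (connected_setU1 (y := w1) e_sym c3);
    [rewrite !inE eqxx !orbT | rewrite e_sym].
by apply: (connected_setU1 (y := w2) e_sym c4);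
  [rewrite !inE eqxx !orbT | rewrite e_sym].
Qed.

Lemma nonfixed_reducible a : (forall x y : V, connect e x y) ->
  ~~ fixed e a -> reducible a.
Proof.
move=> econ /nonfixedP[i ai].
pose P S := [/\ connected_set e S, S0 \subset S & reduces S].
have [_ _ redT] : P [set: V].
  apply: (connected_setT_ind e_sym (S := S0) econ (mem_S0 (k := 0%N) isT)).
    by split; [exact: S0_connected | | exact: E6_reduces].
  move=> T x y [Tc T0 redT] xT yT xy; split.
  - exact: connected_setU1 xy.
  - by apply: subset_trans T0 (subsetUr _ _).
  exact: reducesU1 xy redT.
by apply: redT; [move=> x; rewrite inE | exists i].
Qed.

End E6.

(** * Extracting the six vertices of E6 from the arms *)

Section Arms.

Variables (V : finType) (e : rel V).
Hypothesis e_sym : symmetric e.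

Lemma arm_nbrs (v : V) (A : {set V}) : (forall x y, connect e x y) ->
    A \in arms e v -> (2 <= #|A|)%N ->
  exists w u, [/\ A = block e [set~ v] w, e v w, e w u & u != v].
Proof.
move=> econ; rewrite /arms componentsE => /imsetP[z]; rewrite in_setC1 => zv ->.
set C := [set~ v].
have [w vw wz] : exists2 w, e v w & connect (induced e C) w z.
  (* Along a walk from [v] to [z], [w] records the vertex entered after the last visit to [v]. *)
  have : z = v \/ exists2 w, e v w & connect (induced e C) w z.
    apply: (connect_ind
      (P := fun t => t = v \/ exists2 w, e v w & connect (induced e C) w t)
      (econ v z)); first by left.
    move=> t r IHt tr; have [->|rv] := eqVneq r v; first by left.
    right; have [tv|tv] := eqVneq t v; first by exists r; rewrite // -tv.
    case: IHt => [tv'|[w vw wt]]; first by rewrite tv' eqxx in tv.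
    exists w => //; apply: connect_trans wt (connect1 _).
    by rewrite /induced /= !inE tv rv.
  by case=> // zv'; rewrite zv' eqxx in zv.
rewrite -(block_eq e_sym wz) => /card_gt1P[x [y [xA yA xy]]].
have [t tA tw] : exists2 t, t \in block e C w & t != w.
  have [xw|xw] := eqVneq x w; last by exists x.
  by exists y; rewrite // -xw eq_sym.
have wt : connect (induced e C) w t by move: tA; rewrite inE => /andP[].
have : t = w \/ exists2 u, e w u & u != v.
  apply: (connect_ind (P := fun t => t = w \/ exists2 u, e w u & u != v) wt).
    by left.
  move=> r r' [->|]; last by right.
  by case/and3P=> _; rewrite in_setC1 => rv wr; right; exists r'.
case=> [tw'|[u wu uv]]; first by rewrite tw' eqxx in tw.
by exists w, u.
Qed.

(** Two distinct arms with at least two vertices supply [w1], [u1] and [w2], [u2]; the degree bound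
    leaves a third neighbour [w3]. *)
Lemma contains_E6_vertices : (forall x y, connect e x y) -> contains_E6 e ->
  exists v w1 w2 w3 u1 u2,
    [/\ e v w1, e v w2, e v w3, w1 != w2 & w1 != w3] /\
    [/\ w2 != w3, e w1 u1, e w2 u2, u1 != v & u2 != v].
Proof.
move=> econ [v [deg3 /card_gt1P[A [B [+ + AB]]]]].
rewrite !inE => /andP[Aarm A2] /andP[Barm B2].
have [w1 [u1 [AE vw1 wu1 u1v]]] := arm_nbrs econ Aarm A2.
have [w2 [u2 [BE vw2 wu2 u2v]]] := arm_nbrs econ Barm B2.
have w12 : w1 != w2 by apply: contraNneq AB => w12; rewrite AE BE w12.
have : (0 < #|[set w | e v w] :\ w1 :\ w2|)%N.
  have := deg3; rewrite /degree (cardsD1 w1) (cardsD1 w2 (_ :\ _)).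
  by rewrite !inE vw1 vw2 eq_sym w12.
case/card_gt0P=> w3; rewrite !inE => /and3P[w32 w31 vw3].
by exists v, w1, w2, w3, u1, u2; do !split; rewrite // eq_sym.
Qed.

End Arms.

(** * The partition into equivalence classes *)

Theorem theorem3p1 (V : finType) (e : rel V)
    (treeD : tree e) (D_E6 : contains_E6 e) :
  equiv_classes e =
    [set [set a] | a : labeling V & fixed e a]
      :|: [set nonfixed_odd e; nonfixed_even e]
  /\ nonfixed_odd e != nonfixed_even e.
Proof.
case: treeD => -[e_sym e_irr] [_ econ] e_ac.
have [v [w1 [w2 [w3 [u1 [u2 [[vw1 vw2 vw3 w12 w13] [w23 wu1 wu2 u1v u2v]]]]]]]] :=
  contains_E6_vertices e_sym econ D_E6.
have red a : ~~ fixed e a -> reducible e v w1 w2 a.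
  exact: (nonfixed_reducible e_sym e_irr e_ac vw1 vw2 vw3 w12 w13 w23
    wu1 wu2 u1v u2v econ).
have odd1 : odd (num_components e (dl v)) by apply: odd_num_components_vertex.
have even2 : ~~ odd (num_components e (dl w1 + dl w2)).
  by apply: odd_num_components_pair => //; rewrite (nbr_notadj e_sym e_irr e_ac vw1 vw2).
have nf1 : ~~ fixed e (dl v).
  by apply/nonfixedP; exists w1; rewrite nbsum_dl e_sym vw1.
have nf2 : ~~ fixed e (dl w1 + dl w2).
  apply/nonfixedP; exists u1; rewrite nbsumD !nbsum_dl !(e_sym u1) wu1.
  by rewrite (nbr_nbr_notadj e_sym e_irr e_ac vw1 vw2 w12 u1v wu1) addr0.
have classE a : ~~ fixed e a -> [set b in [set: labeling V] | equiv e a b] =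
    if odd (num_components e a) then nonfixed_odd e else nonfixed_even e.
  move=> nfa.
  transitivity [set b | ~~ fixed e b &
      odd (num_components e b) == odd (num_components e a)]; last first.
    by case: ifP => _; apply/setP=> b; rewrite !inE ?eqb_id ?eqbF_neg.
  apply/setP=> b; rewrite !inE; apply/idP/andP=> [ab|[nfb /eqP pab]].
    rewrite -(equiv_fixed e_irr ab) nfa.
    by rewrite (odd_num_components_equiv e_sym e_irr e_ac ab).
  have sym c d : equiv e c d -> equiv e d c by rewrite /equiv (equiv_sym e_irr).
  have par := odd_num_components_equiv e_sym e_irr e_ac.
  (* Labelings reduced to the same representative are equivalent; different representatives would
     contradict equality of parities. *)
  case: (red a nfa) (red b nfb) => aE [] bE.
  - exact: connect_trans aE (sym _ _ bE).
  - by move: pab; rewrite (par _ _ aE) (par _ _ bE) odd1 (negbTE even2).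
  - by move: pab; rewrite (par _ _ aE) (par _ _ bE) odd1 (negbTE even2).
  - exact: connect_trans aE (sym _ _ bE).
split; last first.
  (* The odd class contains [dl v], which the even one does not. *)
  apply/negP=> /eqP/setP/(_ (dl v)).
  by rewrite !inE nf1 odd1.
have fixE a : fixed e a -> [set b in [set: labeling V] | equiv e a b] = [set a].
  move=> fa; apply/setP=> b; rewrite !inE; apply/idP/eqP=> [|->].
    exact: fixed_equiv.
  exact: connect0.
apply/setP=> X; apply/imsetP/idP => [[a _ ->]|].
  rewrite in_setU; case: (boolP (fixed e a)) => fa.
    by rewrite fixE // imset_f // inE.
  by rewrite classE // !inE; case: ifP; rewrite eqxx ?orbT.
case/setUP=> [/imsetP[a + ->]|/set2P[]->].
- by rewrite inE => fa; exists a; rewrite // fixE.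
- by exists (dl v); rewrite // classE // odd1.
by exists (dl w1 + dl w2); rewrite // classE // (negbTE even2).
Qed.
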